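(* Let $n,p\ge1$ be integers, let $\mu$ be a probability mass function on $\{0,1,\dots,n\}$, and let $\widetilde Q_{\mu,p}:=\sum_{u=0}^{n}\mu(n-u)\,\widetilde Q_{n-u,p}$ and $S_\mu(\ell):=\sum_{u=0}^{\ell}\mu(n-u)\,u!\,p^u$ for $0\le\ell\le n$. If $\widetilde Q_{\mu,p}=U$, then $\|\widetilde Q_{\mu,p}-U\|_{\mathrm{TV}}=0$. Assume $\widetilde Q_{\mu,p}\ne U$, and define $$w_\mu:=\min\{\ell\in\{0,1,\dots,n\}:S_\mu(\ell)>1\}.$$ Then $w_\mu$ is well defined with $w_\mu\in\{1,\dots,n\}$ (indeed $w_\mu\ge2$ when $p=1$), and $$\|\widetilde Q_{\mu,p}-U\|_{\mathrm{TV}}=\widetilde Q_{\mu,p}(A_{w_\mu})-U(A_{w_\mu}).$$ Moreover, $$\|\widetilde Q_{\mu,p}-U\|_{\mathrm{TV}}=1-\sum_{u=0}^{w_\mu-1}\mu(n-u)+\frac{1}{w_\mu!\,p^{w_\mu}}\left(\sum_{u=0}^{w_\mu-1}\mu(n-u)\,u!\,p^u-1\right).$$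
   Context: For integers $n,p\ge1$, $C_p=\mathbb Z/p\mathbb Z$ (written additively) and $G_{n,p}=C_p\wr S_n$ is the group of $p$-colored permutations, realized as $C_p^{\,n}\times S_n$ with multiplication $(t,\tau)(s,\sigma)=(\sigma t+s,\tau\sigma)$, $\sigma t:=(t_{\sigma(1)},\dots,t_{\sigma(n)})$. In $(s,\sigma)$, position $i$ carries the label $\sigma(i)$ with color $s_i$. $U$ is the uniform law on $G_{n,p}$. For $0\le u\le n$, $A_u\subseteq G_{n,p}$ is the set of $(s,\sigma)$ with $\sigma^{-1}(n-u+1)<\cdots<\sigma^{-1}(n)$ and $s_{\sigma^{-1}(j)}=0$ for $n-u+1\le j\le n$ (so $A_0=G_{n,p}$), and $\widetilde Q_{n-u,p}$ is the uniform probability measure on $A_u$. $\|M-N\|_{\mathrm{TV}}=\frac12\sum_x|M(x)-N(x)|$. *)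

(* Defs.v *)
From HB Require Import structures.
From mathcomp Require Import all_boot all_order all_algebra all_fingroup.

Set Implicit Arguments.
Unset Strict Implicit.
Unset Printing Implicit Defensive.

Import Order.TTheory GRing.Theory Num.Theory.
Local Open Scope ring_scope.

(* C_p for p >= 1. 'Z_p is avoided because 'Z_1 has two elements; the
   predecessor-successor makes the additive group structure of 'I_p available. *)
Definition Cp (p : nat) : Type := 'I_p.-1.+1.
HB.instance Definition _ p := Finite.on (Cp p).
HB.instance Definition _ p := GRing.Zmodule.on (Cp p).

(* The pair (s, sigma): position i carries the label sigma i with color s i.
   Positions and labels are 0-based: the label j in {1..n} is j.-1 : 'I_n. *)
Definition colored_perm (n p : nat) : Type :=
  ({ffun 'I_n -> Cp p} * 'S_n)%type.
HB.instance Definition _ n p := Finite.on (colored_perm n p).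

Section WreathProduct.
Variables n p : nat.
Implicit Types g h : colored_perm n p.

(* (t, tau)(s, sigma) = (sigma t + s, tau sigma), where tau sigma is
   the composite i |-> tau (sigma i); the product of perm.v composes in the
   opposite order, hence the swap in the second component. *)
Definition cp_mul g h : colored_perm n p :=
  ([ffun i => g.1 (h.2 i) + h.1 i], (h.2 * g.2)%g).
Definition cp_one : colored_perm n p := ([ffun=> 0], 1%g).
Definition cp_inv g : colored_perm n p :=
  ([ffun i => - g.1 ((g.2^-1)%g i)], (g.2^-1)%g).

Fact cp_mulA : associative cp_mul.
Proof.
move=> f g h; congr pair; last by rewrite /= mulgA.
by apply/ffunP => i; rewrite !ffunE /= permM addrA.
Qed.

Fact cp_mul1 : left_id cp_one cp_mul.
Proof.
case=> s sigma; congr pair; last by rewrite /= mulg1.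
by apply/ffunP => i; rewrite !ffunE add0r.
Qed.

Fact cp_mulV : left_inverse cp_one cp_inv cp_mul.
Proof.
case=> s sigma; congr pair; last by rewrite /= mulgV.
by apply/ffunP => i; rewrite !ffunE /= permK addNr.
Qed.

End WreathProduct.

HB.instance Definition _ n p :=
  Finite_isGroup.Build (colored_perm n p)
    (@cp_mulA n p) (@cp_mul1 n p) (@cp_mulV n p).

(* A_u: the u largest labels (0-based: n - u <= j < n) appear in increasing
   order of position, all with color 0. *)
Definition Aset (n p u : nat) : {set colored_perm n p} :=
  [set g : colored_perm n p |
    [forall i : 'I_n, forall j : 'I_n,
      (n - u <= i < j)%N ==> ((g.2^-1)%g i < (g.2^-1)%g j)%N]
    && [forall j : 'I_n, (n - u <= j)%N ==> (g.1 ((g.2^-1)%g j) == 0)]].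

Section FiniteMeasures.
Variables (R : realFieldType) (T : finType).

Definition uniform_on (A : {set T}) : {ffun T -> R} :=
  [ffun x => if x \in A then #|A|%:R^-1 else 0].

Definition measure_of (M : {ffun T -> R}) (A : {set T}) : R :=
  \sum_(x in A) M x.

Definition TV (M N : {ffun T -> R}) : R := 2^-1 * \sum_x `|M x - N x|.

Definition is_pmf (m : T -> R) : Prop := (forall x, 0 <= m x) /\ \sum_x m x = 1.

End FiniteMeasures.

Section Shuffles.
Variables (R : realFieldType) (n p : nat).

Definition unifG : {ffun colored_perm n p -> R} := uniform_on R [set: _].

Definition Qtilde (m : nat) : {ffun colored_perm n p -> R} :=
  uniform_on R (Aset n p (n - m)).

Variable mu : 'I_n.+1 -> R.

(* sub_ord u is n - u as an element of {0, ..., n}. *)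
Definition Qtilde_mu : {ffun colored_perm n p -> R} :=
  [ffun g => \sum_(0 <= u < n.+1) mu (sub_ord u) * Qtilde (n - u) g].

Definition Smu (l : nat) : R :=
  \sum_(0 <= u < l.+1) mu (sub_ord u) * (u`! * p ^ u)%:R.

Definition wset : {set 'I_n.+1} := [set l : 'I_n.+1 | 1 < Smu l].

(* The minimum of wset when wset is nonempty; otherwise the junk value 0. *)
Definition wmu : 'I_n.+1 := [arg min_(l < ord0 in wset) (l : nat)]%N.

End Shuffles.

(* Main.v *)
(* The sets A_u decrease in u and |A_u| = |G| / (u! p^u), so the density of
   Q with respect to U at g is S_mu(l), where l is the largest u with g in A_u.
   As S_mu is nondecreasing, Q >= U exactly on A_w, which makes A_w a witness of
   the total variation distance; if S_mu never exceeded 1 then Q <= U pointwise,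
   hence Q = U.
   The cardinality of A_u comes from the subgroup H_u (order u! p^u) permuting
   and recoloring the u largest labels: every g factors uniquely as h * a with
   h in H_u and a in A_u, where a is obtained from g by sorting these labels and
   erasing their colors. *)

Require Import Defs.
From mathcomp Require Import all_boot all_order all_algebra all_fingroup.

Set Implicit Arguments.
Unset Strict Implicit.
Unset Printing Implicit Defensive.

Import Order.TTheory GRing.Theory Num.Theory.
Local Open Scope ring_scope.

(** * Rigidity of increasing permutations *)

(** Induction gives [i <= t i] for every [i]; as [t] permutes the indices, both sides have the same
    sum, so every inequality is an equality. *)
Lemma homo_perm_eq1 n (t : 'S_n) :
  {homo t : i j / (i < j)%N} -> t = 1%g.
Proof.
move=> t_incr; have t_ge m (i : 'I_n) : (i < m)%N -> (i <= t i)%N.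
  elim: m i => // m IHm i; rewrite ltnS => le_im.
  case: (posnP i) => [-> // | i_gt0].
  have lt_n : (i.-1 < n)%N by rewrite (leq_ltn_trans (leq_pred i)).
  have lt_i : (Ordinal lt_n < i)%N by rewrite /= prednK.
  have := IHm (Ordinal lt_n) (leq_trans lt_i le_im).
  by move/leq_ltn_trans/(_ (t_incr _ _ lt_i)); rewrite /= prednK.
have t_sum : (\sum_i t i = \sum_(i < n) i)%N.
  by rewrite [RHS](reindex_inj (@perm_inj _ t)).
have/eqP := esym t_sum.
have t_geif (i : 'I_n) : true -> (i <= t i ?= iff (i == t i :> nat))%N.
  by move=> _; apply/leqif_eq/(t_ge i.+1).
rewrite (leqif_sum t_geif).
move/forallP=> t_eq; apply/permP => i; rewrite perm1.
by apply/val_inj/esym/eqP/t_eq.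
Qed.

(** * Unique factorization of the group and the size of A_u *)

Section AsetCard.
Variables n p : nat.
Implicit Types (u : nat) (g h : colored_perm n p).

Definition top_labels u : {set 'I_n} := [set j : 'I_n | (n - u <= j)%N].

Lemma card_top_labels u : (u <= n)%N -> #|top_labels u| = u.
Proof.
move=> le_un; rewrite -sum1_card.
under eq_bigl => j do rewrite inE.
rewrite -(big_mkord (fun j => n - u <= j)%N (fun=> 1%N)).
rewrite -(@big_nat_widenl _ _ _ (n - u) 0 n xpredT) //.
by rewrite sum_nat_const_nat muln1 subKn.
Qed.

(** Left multiplication by [h] turns a label [j] into [h.2 j] and adds [h.1 j] to its color, so the
    indices of [h] act as labels and positions stay put. *)
Definition relabelings u : {set colored_perm n p} :=
  [set h : colored_perm n p |
    (h.1 \in pffun_on 0 (top_labels u) predT) && perm_on (top_labels u) h.2].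

Lemma card_relabelings u : (1 <= p)%N -> (u <= n)%N ->
  #|relabelings u| = (u`! * p ^ u)%N.
Proof.
move=> p_gt0 le_un.
have -> : relabelings u =
    setX [set s : {ffun 'I_n -> Cp p} | s \in pffun_on 0 (top_labels u) predT]
         [set t : 'S_n | perm_on (top_labels u) t].
  by apply/setP => h; rewrite !inE.
rewrite cardsX !cardsE card_perm card_pffun_on card_top_labels //.
by rewrite card_ord prednK // mulnC.
Qed.

Lemma AsetP u g :
  reflect ((forall i j : 'I_n, (n - u <= i < j)%N ->
              ((g.2^-1)%g i < (g.2^-1)%g j)%N)
           /\ (forall i : 'I_n, (n - u <= g.2 i)%N -> g.1 i = 0))
          (g \in Aset n p u).
Proof.
rewrite inE; apply: (iffP andP) => -[incr col0]; split.
- by move=> i j lt_ij; move/'forall_forallP/(_ i j)/implyP: incr; apply.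
- move=> i le_i; move/forallP/(_ (g.2 i))/implyP/(_ le_i)/eqP: col0.
  by rewrite permK.
- by apply/'forall_forallP => i j; apply/implyP/incr.
- by apply/forallP => j; apply/implyP => le_j; rewrite col0 // permKV.
Qed.

Lemma relabelingsP u h :
  reflect (forall j : 'I_n, (j < n - u)%N -> h.1 j = 0 /\ h.2 j = j)
          (h \in relabelings u).
Proof.
rewrite inE; apply: (iffP andP) => [[/pffun_onP[supp _] fixp] j lt_j | fixp].
  have jN : j \notin top_labels u by rewrite inE -ltnNge.
  split; last exact: out_perm fixp jN.
  by apply/eqP; apply: contraR jN => nz; apply: (subsetP supp).
have out j : j \notin top_labels u -> h.1 j = 0 /\ h.2 j = j.
  by rewrite inE -ltnNge => /fixp.
split.
  apply/pffun_onP; split=> //; apply/subsetP=> j; rewrite inE.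
  apply: contraR => /out[-> _].
  by rewrite eqxx.
by apply/subsetP => j; rewrite inE; apply: contraR => /out[_ ->].
Qed.

Lemma cp_mulE g h : (g * h)%g = cp_mul g h. Proof. by []. Qed.

Lemma relabelings_top u h j : h \in relabelings u ->
  (n - u <= h.2 j)%N = (n - u <= j)%N.
Proof.
rewrite inE => /andP[_ h2]; have := perm_closed j h2.
by rewrite !inE.
Qed.

Lemma relabelings_mulVg u h k : h \in relabelings u -> k \in relabelings u ->
  (h^-1 * k)%g \in relabelings u.
Proof.
move=> /relabelingsP hH /relabelingsP kH; apply/relabelingsP => j lt_j.
have [k1 k2] := kH j lt_j; have [h1 h2] := hH j lt_j.
have h2V : (h.2^-1)%g j = j by rewrite -[in LHS]h2 permK.
by rewrite cp_mulE /= permM ffunE /= ffunE k2 h2V k1 h1 oppr0 addr0.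
Qed.

(** Since [k] moves no position, two increasing arrangements of the top labels force [k.2] to be
    increasing; two zero colorings then force [k.1] to vanish. *)
Lemma relabelings_Aset_eq1 u k a :
  k \in relabelings u -> a \in Aset n p u ->
  (k * a)%g \in Aset n p u -> k = 1%g.
Proof.
move=> kH /AsetP[a_incr a_col] /AsetP[b_incr b_col].
have k2_top := relabelings_top _ kH; have kP := relabelingsP _ _ kH.
have pos j : ((k * a)%g.2^-1)%g (k.2 j) = (a.2^-1)%g j.
  by rewrite cp_mulE /= invMg permM permK.
have k2_eq1 : k.2 = 1%g.
  apply: homo_perm_eq1 => i j lt_ij.
  case: (ltnP j (n - u)) => [lt_j | le_j].
    by have [[_ ->] [_ ->]] := (kP j lt_j, kP i (ltn_trans lt_ij lt_j)).
  case: (ltnP i (n - u)) => [lt_i | le_i].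
    have [_ ->] := kP i lt_i.
    by apply: leq_trans lt_i _; rewrite k2_top.
  (* If [k.2] reversed [i < j], then [k * a] would place [k.2 j] before [k.2 i], hence [a] would
     place [j] before [i]. *)
  case: (ltngtP (k.2 i) (k.2 j)) => // [lt_k | eq_k].
    have:= b_incr (k.2 j) (k.2 i); rewrite k2_top le_j lt_k !pos => /(_ isT).
    by rewrite ltnNge ltnW // a_incr // le_i.
  by move: lt_ij; rewrite (perm_inj (val_inj eq_k)) ltnn.
rewrite [k]surjective_pairing k2_eq1; congr pair; apply/ffunP => j.
rewrite ffunE; case: (ltnP j (n - u)) => [/kP[-> //] | le_j].
have := b_col ((a.2^-1)%g j).
rewrite cp_mulE /= permM ffunE permKV a_col ?addr0 ?permKV //.
by apply; rewrite k2_top.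
Qed.

(** Two factorizations of one element differ by [h'^-1 * h], which carries [a] to [a'], and both lie
    in A_u. *)
Lemma relabelings_mul_inj u :
  {in setX (relabelings u) (Aset n p u) &,
     injective (fun x : colored_perm n p * colored_perm n p => (x.1 * x.2)%g)}.
Proof.
move=> [h a] [h' a'] /setXP[/= hH aA] /setXP[/= hH' aA'] eq_ha.
have eq_a : (h'^-1 * h * a)%g = a' by rewrite -mulgA eq_ha mulKg.
have k1 : (h'^-1 * h)%g = 1%g.
  by apply: relabelings_Aset_eq1 (relabelings_mulVg hH' hH) aA _; rewrite eq_a.
congr pair; last by rewrite -eq_a k1 mul1g.
by rewrite -[h](mulKVg h') k1 mulg1.
Qed.

(** * Existence of the factorization, by sorting *)

Section Sorting.
Variables (u : nat) (le_un : (u <= n)%N) (g : colored_perm n p).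

Let top_pos : {set 'I_n} := [set i : 'I_n | (n - u <= g.2 i)%N].

Let card_top_pos : #|top_pos| = u.
Proof.
rewrite -[RHS](card_top_labels le_un) -(card_imset _ (@perm_inj _ g.2)).
congr #|pred_of_set _|; apply/setP => j; rewrite inE; apply/imsetP/idP.
  by move=> [i]; rewrite inE => ? ->.
by move=> le_j; exists ((g.2^-1)%g j); rewrite ?inE permKV.
Qed.

Let rank (i : 'I_n) := #|[set k in top_pos | (k < i)%N]|.

Let rank_incr (i j : 'I_n) : i \in top_pos -> (i < j)%N -> (rank i < rank j)%N.
Proof.
move=> iP lt_ij; apply: proper_card; apply/properP; split.
  by apply/subsetP => k; rewrite !inE => /andP[-> /ltn_trans->].
by exists i; rewrite inE iP ?lt_ij ?ltnn.
Qed.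

(** Sorting writes [n - u + rank i] at a top position and keeps the other labels; [rank i < u]
    because [rank] does not count [i] itself. *)
Let sorted_lt (i : 'I_n) :
  ((if i \in top_pos then n - u + rank i else g.2 i) < n)%N.
Proof.
case: ifP => // iP; rewrite -[ltnRHS](subnK le_un) ltn_add2l -card_top_pos.
apply: proper_card; apply/properP; split.
  by apply/subsetP => k; rewrite inE => /andP[].
by exists i => //; rewrite inE ltnn andbF.
Qed.

Let sorted_label i := Ordinal (sorted_lt i).

Let sorted_label_inj : injective sorted_label.
Proof.
move=> i j /(congr1 val) /=.
case: ifP => iP; case: ifP => jP eq_ij; last exact/(@perm_inj _ g.2)/val_inj.
- move/addnI: eq_ij => eq_ij; apply/val_inj/eqP.
  by case: ltngtP => // [/(rank_incr iP) | /(rank_incr jP)];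
     rewrite eq_ij ltnn.
- by move: jP; rewrite inE -eq_ij leq_addr.
- by move: iP; rewrite inE eq_ij leq_addr.
Qed.

Lemma relabelings_mul_surj :
  exists h a, [/\ h \in relabelings u, a \in Aset n p u & g = (h * a)%g].
Proof.
pose a : colored_perm n p :=
  ([ffun i => if i \in top_pos then 0 else g.1 i], perm sorted_label_inj).
have a2_top i : (n - u <= a.2 i)%N = (i \in top_pos).
  by rewrite permE /=; case: ifP => iP; [rewrite leq_addr | rewrite inE in iP].
exists (g * a^-1)%g, a; split; last by rewrite mulgKV.
  (* A label below [n - u] has the same position and color in [g] and [a], so [g * a^-1] fixes it
     without recoloring. *)
  apply/relabelingsP => j lt_j; set i := (a.2^-1)%g j.
  have ai : a.2 i = j by rewrite permKV.
  have iN : i \notin top_pos by rewrite -a2_top ai -ltnNge.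
  have gi : g.2 i = j.
    by apply/val_inj; rewrite -ai permE /= (negPf iN).
  rewrite cp_mulE /= permM -/i gi; split=> //.
  by rewrite !ffunE -/i (negPf iN) subrr.
apply/AsetP; split=> [j k /andP[le_j lt_jk] | i]; last first.
  by rewrite a2_top ffunE => ->.
have [jK kK] : a.2 ((a.2^-1)%g j) = j /\ a.2 ((a.2^-1)%g k) = k.
  by rewrite !permKV.
(* Passing from labels to their positions reduces the claim to: [rank i < rank l] implies
   [i < l]. *)
move: ((a.2^-1)%g j) ((a.2^-1)%g k) jK kK => i l ij lk.
have iP : i \in top_pos by rewrite -a2_top ij.
have lP : l \in top_pos.
  by rewrite -a2_top lk (leq_trans le_j) // ltnW.
move: lt_jk; rewrite -ij -lk !permE /= iP lP ltn_add2l.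
apply: contraTT; rewrite -!leqNgt leq_eqVlt => /predU1P[/val_inj-> //|].
by move/(rank_incr lP)/ltnW.
Qed.

End Sorting.

Lemma card_Aset u : (1 <= p)%N -> (u <= n)%N ->
  (u`! * p ^ u * #|Aset n p u| = #|[set: colored_perm n p]|)%N.
Proof.
move=> p_gt0 le_un; rewrite -card_relabelings // -cardsX.
rewrite -(card_in_imset (@relabelings_mul_inj u)).
congr #|pred_of_set _|; apply/setP => g; rewrite [RHS]inE.
have [h [a [hH aA ->]]] := relabelings_mul_surj le_un g.
by apply/imsetP; exists (h, a) => //; apply/setXP.
Qed.

End AsetCard.

Lemma Aset_leq n p u v g : (u <= v)%N -> g \in Aset n p v -> g \in Aset n p u.
Proof.
move=> le_uv /AsetP[incr col0]; have le_nv := leq_sub2l n le_uv.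
apply/AsetP; split=> [i j /andP[le_i lt_ij] | i le_i].
  by apply: incr; rewrite (leq_trans le_nv).
by apply: col0; apply: leq_trans le_i.
Qed.

(** * Total variation of finite measures *)

Section FiniteMeasureTheory.
Variables (R : realFieldType) (T : finType).
Implicit Types (M N : {ffun T -> R}) (A B : {set T}).

Lemma measure_of_uniform_on A B :
  measure_of (uniform_on R A) B = #|A :&: B|%:R / #|A|%:R.
Proof.
rewrite /measure_of; under eq_bigr => x _ do rewrite ffunE.
rewrite -big_mkcondr -[in RHS]sum1_card natr_sum mulr_suml.
by apply: eq_big => [x|x _]; rewrite ?inE ?mul1r // andbC.
Qed.

(** Equal total masses make the excess of [M] on [A] equal to its deficit off [A], so half the
    absolute sum is the excess alone. *)
Lemma TV_eq_measureB M N A : \sum_x M x = \sum_x N x ->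
  {in A, forall x, N x <= M x} -> {in ~: A, forall x, M x <= N x} ->
  TV M N = measure_of M A - measure_of N A.
Proof.
move=> eqMN geA leA; rewrite /TV (bigID (mem A)) /=.
rewrite (eq_bigr (fun x => M x - N x)); last first.
  by move=> x xA; rewrite ger0_norm ?subr_ge0 ?geA.
rewrite [X in _ + X](eq_bigr (fun x => N x - M x)); last first.
  by move=> x xA; rewrite distrC ger0_norm ?subr_ge0 ?leA // inE.
move: eqMN; rewrite (bigID (mem A)) /= [RHS](bigID (mem A)) /= !sumrB.
rewrite /measure_of => eqMN.
set a := \sum_(x in A) M x in eqMN *; set b := \sum_(x in A) N x in eqMN *.
set c := \sum_(x | x \notin A) M x in eqMN *.
set d := \sum_(x | x \notin A) N x in eqMN *.
have -> : d - c = a - b.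
  apply/eqP; rewrite subr_eq addrAC eq_sym subr_eq.
  by rewrite addrC [d + b]addrC -eqMN addrC.
by rewrite -mulr2n -[(a - b) *+ 2]mulr_natl mulKf // pnatr_eq0.
Qed.

Lemma ffun_eq_of_le M N :
  \sum_x M x = \sum_x N x -> (forall x, M x <= N x) -> M = N.
Proof.
move=> eqMN leMN; apply/ffunP => x; apply/eqP; rewrite eq_sym -subr_eq0.
have/eqP := sumrB (index_enum T) xpredT N M; rewrite eqMN subrr.
rewrite psumr_eq0 => [/allP/(_ x (mem_index_enum x))//|y _].
by rewrite subr_ge0.
Qed.

End FiniteMeasureTheory.

(** * The mixture, its density and S_mu *)

Section Mixture.
Variables (R : realFieldType) (n p : nat) (mu : 'I_n.+1 -> R).
Hypotheses (p_gt0 : (1 <= p)%N) (mu_pmf : is_pmf mu).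
Implicit Type u : nat.

Local Notation G := (colored_perm n p).
Local Notation card_G := (#|[set: colored_perm n p]|).
Local Notation weight u := (u`! * p ^ u)%N.
Local Notation Q := (Qtilde_mu p mu).
Local Notation U := (unifG R n p).

Let mu_ge0 i : 0 <= mu i. Proof. by case: mu_pmf. Qed.

Let card_G_gt0 : 0 < card_G%:R :> R.
Proof. by rewrite ltr0n; apply/card_gt0P; exists 1%g; rewrite inE. Qed.

Lemma weight_neq0 u : (weight u)%:R != 0 :> R.
Proof.
by rewrite pnatr_eq0 muln_eq0 negb_or -!lt0n fact_gt0 expn_gt0 p_gt0.
Qed.

Lemma card_Aset_natr u : (u <= n)%N ->
  #|Aset n p u|%:R = card_G%:R / (weight u)%:R :> R.
Proof.
move=> le_un; rewrite -(card_Aset p_gt0 le_un) natrM.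
by rewrite mulrAC mulfV ?mul1r // weight_neq0.
Qed.

Lemma measure_unifG_Aset u : (u <= n)%N ->
  measure_of U (Aset n p u) = (weight u)%:R^-1.
Proof.
move=> le_un; rewrite measure_of_uniform_on setTI card_Aset_natr //.
by rewrite mulrAC mulfV ?mul1r // gt_eqF.
Qed.

Lemma Aset0 : Aset n p 0 = [set: G].
Proof.
apply/setP=> g; rewrite [RHS]inE; apply/AsetP; rewrite subn0.
by split=> [i j | i]; rewrite leqNgt ltn_ord.
Qed.

Lemma sum_mu_sub_ord : \sum_(0 <= u < n.+1) mu (sub_ord u) = 1.
Proof.
case: mu_pmf => _ <-; rewrite big_mkord [RHS](reindex_inj rev_ord_inj).
by apply: eq_bigr => i _; congr mu; apply: val_inj; rewrite /= subSS.
Qed.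

(** The sum is the density with respect to U: each A_u containing [g] contributes [mu (sub_ord u)]
    times |G| / |A_u|. *)
Lemma Qtilde_muE g : Q g =
  card_G%:R^-1
    * \sum_(0 <= u < n.+1 | g \in Aset n p u) mu (sub_ord u) * (weight u)%:R.
Proof.
rewrite ffunE mulr_sumr [RHS]big_mkcond; apply: eq_big_nat => u /andP[_ lt_u].
rewrite ffunE subKn //; case: ifP => _; last by rewrite mulr0.
by rewrite card_Aset_natr // invf_div mulrA [RHS]mulrC.
Qed.

Lemma measure_Qtilde_mu B : measure_of Q B =
  \sum_(0 <= u < n.+1)
     mu (sub_ord u) * (#|Aset n p u :&: B|%:R / #|Aset n p u|%:R).
Proof.
rewrite /measure_of; under eq_bigr => g _ do rewrite ffunE.
rewrite exchange_big /=; apply: eq_big_nat => u /andP[_ lt_u].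
by rewrite -mulr_sumr -measure_of_uniform_on /Qtilde subKn.
Qed.

(** By nesting, the uniform law on A_u gives A_w mass 1 if [u >= w], and |A_w| / |A_u|, the ratio of
    weights at [u] and [w], if [u < w]. *)
Lemma measure_Qtilde_mu_Aset w : (w <= n)%N -> measure_of Q (Aset n p w) =
  1 - \sum_(0 <= u < w) mu (sub_ord u)
    + (weight w)%:R^-1 * \sum_(0 <= u < w) mu (sub_ord u) * (weight u)%:R.
Proof.
move=> le_wn; rewrite measure_Qtilde_mu -[X in X - _]sum_mu_sub_ord.
have le_wn1 := leqW le_wn.
rewrite (big_cat_nat (leq0n w) le_wn1) /=.
rewrite [X in _ = X - _ + _](big_cat_nat (leq0n w) le_wn1) /=.
rewrite [X in _ = X - _ + _]addrC addrK addrC mulr_sumr; congr (_ + _).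
  apply: eq_big_nat => u /andP[le_wu lt_u].
  have /setIidPl-> : Aset n p u \subset Aset n p w.
    by apply/subsetP => g; apply: Aset_leq.
  rewrite card_Aset_natr // mulfV ?mulr1 //.
  by rewrite mulf_neq0 ?invr_neq0 ?weight_neq0 ?gt_eqF.
apply: eq_big_nat => u /andP[_ lt_uw]; rewrite [RHS]mulrCA; congr (_ * _).
have /setIidPr-> : Aset n p w \subset Aset n p u.
  by apply/subsetP => g; apply/Aset_leq/ltnW.
rewrite !card_Aset_natr ?(leq_trans (ltnW lt_uw)) //.
by rewrite invf_div mulrC [_ / card_G%:R * _]mulrA mulfVK ?gt_eqF // mulrC.
Qed.

Lemma sum_Qtilde_mu : \sum_g Q g = 1.
Proof.
have := measure_Qtilde_mu_Aset (leq0n n).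
rewrite !big_geq // subr0 mulr0 addr0 Aset0 /measure_of => <-.
by apply: eq_bigl => g; rewrite inE.
Qed.

Lemma sum_unifG : \sum_g U g = 1.
Proof.
have := measure_unifG_Aset (leq0n n).
rewrite fact0 expn0 invr1 Aset0 /measure_of => <-.
by apply: eq_bigl => g; rewrite inE.
Qed.

Lemma unifGE g : U g = card_G%:R^-1. Proof. by rewrite ffunE inE. Qed.

(** Nesting puts every [u <= w] in the sum of [Qtilde_muE]; the other terms are nonnegative. *)
Lemma Smu_le_Qtilde_mu w g : (w <= n)%N -> g \in Aset n p w ->
  card_G%:R^-1 * Smu p mu w <= Q g.
Proof.
move=> le_wn gA; rewrite Qtilde_muE ler_pM2l ?invr_gt0 //.
rewrite [leRHS]big_mkcond /= (@big_cat_nat _ _ _ w.+1 0 n.+1) //= /Smu.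
rewrite -[leLHS]addr0 lerD //; last first.
  by apply: sumr_ge0 => u _; case: ifP => // _; rewrite mulr_ge0 ?ler0n.
by apply: ler_sum_nat => u /andP[_ le_uw]; rewrite (Aset_leq _ gA).
Qed.

(** The terms beyond [w] vanish; [g] itself may lie outside A_w. *)
Lemma Qtilde_mu_le_Smu w g : (w <= n)%N ->
    (forall u, (w < u <= n)%N -> g \notin Aset n p u) ->
  Q g <= card_G%:R^-1 * Smu p mu w.
Proof.
move=> le_wn gN; rewrite Qtilde_muE ler_pM2l ?invr_gt0 //.
rewrite [leLHS]big_mkcond /= (@big_cat_nat _ _ _ w.+1 0 n.+1) //= /Smu.
rewrite -[leRHS]addr0 lerD //.
  by apply: ler_sum => u _; case: ifP => // _; rewrite mulr_ge0 ?ler0n.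
rewrite big_nat_cond big1 // => u /andP[/andP[lt_wu lt_u] _].
by rewrite ifN // gN // lt_wu.
Qed.

(** With unit weights, S_mu(l) is a partial sum of the total mass 1. This bounds [wmu] from
    below. *)
Lemma Smu_le1 l : (l <= n)%N -> (forall u, (u <= l)%N -> weight u = 1%N) ->
  Smu p mu l <= 1.
Proof.
move=> le_ln weight1; rewrite -[leRHS]sum_mu_sub_ord.
rewrite [leRHS](@big_cat_nat _ _ _ l.+1 0 n.+1) //= /Smu.
rewrite -[leLHS]addr0 lerD ?sumr_ge0 //.
apply: ler_sum_nat => u /andP[_ le_ul].
by rewrite weight1 // mulr1.
Qed.

Lemma wset_neq0 : Q <> U -> wset p mu != set0.
Proof.
move=> neqQU; apply/eqP => wset0; apply: neqQU; apply: ffun_eq_of_le => [|g].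
  by rewrite sum_Qtilde_mu sum_unifG.
(* At index [n] no larger [u] remains, so the upper bound holds for every [g]. *)
apply: (@le_trans _ _ (card_G%:R^-1 * Smu p mu n)).
  apply: Qtilde_mu_le_Smu => // u /andP[lt_nu /(leq_trans lt_nu)].
  by rewrite ltnn.
rewrite unifGE ler_piMr ?invr_ge0 ?ler0n // leNgt.
by apply/negP => Sn; have := in_set0 (ord_max : 'I_n.+1); rewrite -wset0 inE Sn.
Qed.

Lemma wmuP : wset p mu != set0 ->
  1 < Smu p mu (wmu p mu) /\ (forall l, (l < wmu p mu)%N -> Smu p mu l <= 1).
Proof.
case/set0Pn => l0 l0W.
(* arg_minnP does not apply to wmu itself: the default ord0 is not in wset. *)
have [m mW m_min] := arg_minnP (fun l : 'I_n.+1 => l : nat) l0W.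
rewrite /wmu /arg_min /extremum.
case: pickP => [i /andP[iW /forallP i_min] | /(_ m)].
  split=> [|l lt_li]; first by rewrite inE in iW.
  have lt_l : (l < n.+1)%N by apply: ltn_trans lt_li _.
  rewrite leNgt; apply: contraL lt_li => Sl; rewrite -leqNgt.
  by apply: (implyP (i_min (Ordinal lt_l))); rewrite inE.
(* The search cannot fail: the minimizer [m] satisfies its predicate. *)
move/idP; case; apply/andP; split=> //.
by apply/forallP => l; apply/implyP/m_min.
Qed.

End Mixture.

Theorem theorem3p19 (R : realFieldType) (n p : nat) (hn : (1 <= n)%N)
    (hp : (1 <= p)%N) (mu : 'I_n.+1 -> R) (hmu : is_pmf mu) :
  let Q := Qtilde_mu p mu in
  let U := unifG R n p in
  let w : nat := wmu p mu in
  (Q = U -> TV Q U = 0) /\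
  (Q <> U ->
    [/\ wset p mu != set0,
        (1 <= w <= n)%N /\ (p = 1%N -> (2 <= w)%N),
        TV Q U = measure_of Q (Aset n p w) - measure_of U (Aset n p w)
      & TV Q U = 1 - \sum_(0 <= u < w) mu (sub_ord u)
          + (w`! * p ^ w)%:R^-1
            * (\sum_(0 <= u < w) mu (sub_ord u) * (u`! * p ^ u)%:R - 1)]).
Proof.
move=> Q U w; split=> [-> | neqQU].
  by rewrite /TV big1 ?mulr0 // => g _; rewrite subrr normr0.
have wset0 := wset_neq0 hp hmu neqQU.
have [Sw Slt] := wmuP wset0; rewrite -/w in Sw Slt.
have le_wn : (w <= n)%N by rewrite -ltnS ltn_ord.
have w_gt l : (l <= n)%N -> (forall u, (u <= l)%N -> (u`! * p ^ u)%N = 1%N) ->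
    (l < w)%N.
  move=> le_ln weight1; rewrite ltnNge; apply: contraTN Sw => le_wl.
  rewrite -leNgt; apply: Smu_le1 => // u le_uw.
  by apply: weight1; apply: leq_trans le_wl.
have w_gt0 : (0 < w)%N.
  by apply: w_gt => // u; rewrite leqn0 => /eqP->; rewrite fact0 expn0.
have TV_Aw : TV Q U = measure_of Q (Aset n p w) - measure_of U (Aset n p w).
  apply: TV_eq_measureB => [|g gA|g]; rewrite ?unifGE.
  - by rewrite sum_Qtilde_mu // sum_unifG.
  - apply: le_trans (Smu_le_Qtilde_mu hp hmu le_wn gA).
    by rewrite ler_peMr ?invr_ge0 ?ler0n // ltW.
  - rewrite inE => gN.
    (* Outside A_w, [g] lies in no A_u with [u >= w], so the bound applies at [w.-1], where
       minimality gives S_mu at most 1. *)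
    apply: (@le_trans _ _ (#|[set: colored_perm n p]|%:R^-1 * Smu p mu w.-1)).
      apply: Qtilde_mu_le_Smu => // [|u /andP[lt_wu le_un]].
        exact: leq_trans (leq_pred w) le_wn.
      by apply: contra gN; apply: Aset_leq; rewrite -(prednK w_gt0).
    by rewrite ler_piMr ?invr_ge0 ?ler0n // Slt // prednK.
split=> //.
- split=> [|p1]; first by rewrite w_gt0.
  (* Here [l = 1]: for [p = 1] the weights are factorials, and 0! = 1! = 1. *)
  by apply: w_gt => // u; rewrite p1 exp1n muln1; case: u => [|[]].
(* The mass U(A_w), the inverse weight at [w], becomes the [- 1] inside the last factor. *)
- rewrite TV_Aw measure_Qtilde_mu_Aset // measure_unifG_Aset //.
  by rewrite mulrBr mulr1 addrA.
Qed.
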